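(* Suppose that for some integer $r\ge 0$ there is a smooth function $\varphi:(\mathbb{R}^m)^{r+1}\to\mathbb{R}^n$ such that for all $y_0,\dots,y_{r+1}\in\mathbb{R}^m$ $$F\bigl(\varphi(y_0,\dots,y_r),\ \mathcal{L}_\tau\varphi(y_0,\dots,y_{r+1})\bigr)=0,$$ and such that: (1) the map $\Phi:(y_0,\dots,y_{r+1})\mapsto(\varphi(y_0,\dots,y_r),\mathcal{L}_\tau\varphi(y_0,\dots,y_{r+1}))$ is a surjective submersion from $(\mathbb{R}^m)^{r+2}$ onto the manifold $\{(x,p)\in\mathbb{R}^n\times\mathbb{R}^n:F(x,p)=0\}$; (2) the map $y_0\mapsto\varphi(y_0,0,\dots,0)$ is a diffeomorphism from $\mathbb{R}^m$ onto the equilibrium manifold $\{x_0\in\mathbb{R}^n:F(x_0,0)=0\}$. Then the control system $F(x,\dot x)=0$ is locally controllable at every equilibrium point, i.e. at every $x_0\in\mathbb{R}^n$ with $F(x_0,0)=0$.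
   Context: Setting. Let $n>m>0$ be integers and let $F:\mathbb{R}^n\times\mathbb{R}^n\to\mathbb{R}^{n-m}$, $(x,p)\mapsto F(x,p)$, be a smooth function with $\operatorname{rank}\frac{\partial F}{\partial p}=n-m$. The control system is the implicit equation $F(x,\dot x)=0$. It is assumed that for each $x$ there is at least one $p$ with $F(x,p)=0$, and more generally that the manifold $F(x,p)=0$ is parameterized by a smooth function $f:\mathbb{R}^n\times\mathbb{R}^m\to\mathbb{R}^n$ with $F(x,f(x,u))=0$, such that for each fixed $x$ the map $u\mapsto f(x,u)$ is a diffeomorphism onto $\{p:F(x,p)=0\}$. Thus the system is equivalent to the explicit control system $\dot x=f(x,u)$ with control $u\in\mathbb{R}^m$. Notation. For a smooth function $\varphi(y_0,\dots,y_r)$ on $(\mathbb{R}^m)^{r+1}$, $\mathcal{L}_\tau\varphi(y_0,\dots,y_{r+1})=\sum_{i=0}^r\frac{\partial\varphi}{\partial y_i}(y_0,\dots,y_r)\,y_{i+1}$. Local controllability (standard notion). The system is locally controllable at an equilibrium point $x_0$ if for every $T>0$ there is a neighbourhood $V$ of $x_0$ in $\mathbb{R}^n$ such that for all $a,b\in V$ there exist a bounded measurable control $u:[0,T]\to\mathbb{R}^m$ and an absolutely continuous $x:[0,T]\to\mathbb{R}^n$ with $\dot x(t)=f(x(t),u(t))$ for almost every $t$ (so $F(x(t),\dot x(t))=0$ for almost every $t$), $x(0)=a$ and $x(T)=b$. *)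

(* Defs.v *)
From HB Require Import structures.
From mathcomp Require Import all_boot all_order all_algebra.
From mathcomp Require Import all_classical all_reals all_analysis.

Set Implicit Arguments.
Unset Strict Implicit.
Unset Printing Implicit Defensive.

Import Order.TTheory GRing.Theory Num.Theory.
Import numFieldNormedType.Exports.

Local Open Scope classical_set_scope.
Local Open Scope ring_scope.

(* To be used with D open and V finite-dimensional: there, the differential
   x |-> 'd f x is of class C^k iff all the maps 'D_v f are. *)
Fixpoint class_Ck_on (R : realType) (V W : normedModType R) (k : nat)
    (D : set V) (f : V -> W) : Prop :=
  if k is k'.+1 then
    (forall x, D x -> differentiable f x) /\
    (forall v, class_Ck_on k' D ('D_v f))
  else forall x, D x -> {for x, continuous f}.

Definition smooth_on (R : realType) (V W : normedModType R) (D : set V)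
  (f : V -> W) : Prop := forall k, class_Ck_on k D f.

Definition smooth (R : realType) (V W : normedModType R) (f : V -> W) : Prop :=
  smooth_on setT f.

(* The inverse, defined on the subset S of W, is smooth in the usual sense for
   maps on arbitrary subsets: locally it is the restriction of a smooth map h
   defined on an open subset of the ambient space. *)
Definition diffeomorphism_onto (R : realType) (V W : normedModType R)
    (S : set W) (g : V -> W) : Prop :=
  [/\ smooth g, injective g, range g = S &
    forall s, S s -> exists (U : set W) (h : W -> V),
      [/\ open U, U s, smooth_on U h & forall v, U (g v) -> h (g v) = v]].

(* Velocities at q of smooth curves drawn on M; M is meant to be an embedded
   submanifold of V. *)
Definition tangent_space (R : realType) (V : normedModType R)
    (M : set V) (q : V) : set V :=
  [set v | exists (e : R) (c : R -> V),
     [/\ 0 < e, smooth_on `](- e), e[%classic c,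
         forall t, `](- e), e[%classic t -> M (c t), c 0 = q & 'D_1 c 0 = v]].

Definition surjective_submersion (R : realType) (V W : normedModType R)
    (M : set W) (Phi : V -> W) : Prop :=
  [/\ smooth Phi, range Phi = M &
    forall y, tangent_space M (Phi y) `<=` range ('d Phi y)].

(* An element (y_0, ..., y_r) of (R^m)^{r+1} is the matrix with rows y_i;
   [in_row i v] is (0, ..., 0, v, 0, ..., 0), with v at position i. *)
Definition in_row (R : realType) (m k : nat) (i : 'I_k) (v : 'rV[R]_m) :
  'M[R]_(k, m) := delta_mx i (0 : 'I_1) *m v.

(* [row' ord_max Y] is (y_0, ..., y_r) and [row (lift ord0 i) Y] is y_{i+1};
   the i-th term is the partial differential of phi with respect to y_i,
   applied to y_{i+1}. *)
Definition Ltau (R : realType) (n m r : nat)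
    (phi : 'M[R]_(r.+1, m) -> 'rV[R]_n) (Y : 'M[R]_(r.+2, m)) : 'rV[R]_n :=
  \sum_(i < r.+1)
    'D_(in_row i (row (lift ord0 i) Y)) phi (row' ord_max Y).

Definition abs_continuous (R : realType) (V : normedModType R) (a b : R)
    (x : R -> V) : Prop :=
  forall e : R, 0 < e -> exists2 d : R, 0 < d &
    forall (k : nat) (s t : 'I_k -> R),
      (forall i, a <= s i /\ s i <= t i /\ t i <= b) ->
      trivIset setT (fun i => `]s i, t i[%classic) ->
      \sum_(i < k) (t i - s i) < d ->
      \sum_(i < k) `|x (t i) - x (s i)| < e.

(* Controls and trajectories are total functions of which only the values on
   [0, T] matter: the derivative at the endpoints is irrelevant since the
   equation is required almost everywhere. Measurability is Borel and
   coordinatewise; as a control may be changed on a null set, Lebesgue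
   measurable controls would give the same notion. *)
Definition locally_controllable (R : realType) (n m : nat)
    (f : 'rV[R]_n * 'rV[R]_m -> 'rV[R]_n) (x0 : 'rV[R]_n) : Prop :=
  forall T : R, 0 < T -> exists2 V : set 'rV[R]_n, nbhs x0 V &
    forall a b, V a -> V b ->
      exists (u : R -> 'rV[R]_m) (x : R -> 'rV[R]_n),
        [/\ [bounded u t | t in `[0%R, T]%classic] /\
              (forall j, measurable_fun `[0%R, T] (fun t => u t ord0 j)),
            abs_continuous 0 T x,
            {ae lebesgue_measure, forall t : R, `[0%R, T]%classic t ->
               is_derive t (1 : R) x (f (x t, u t))} &
            x 0 = a /\ x T = b].

(* Main.v *)
Require Import Defs.
From HB Require Import structures.
From mathcomp Require Import all_boot all_order all_algebra.
From mathcomp Require Import all_classical all_reals all_analysis.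
From mathcomp Require Import ring lra.

Set Implicit Arguments.
Unset Strict Implicit.
Unset Printing Implicit Defensive.

Import Order.TTheory GRing.Theory Num.Theory.
Import numFieldNormedType.Exports.

Local Open Scope classical_set_scope.
Local Open Scope ring_scope.

(** The system is flat: whatever the curve y in R^m, the curve
    x = phi(y, y', ..., y^(r)) has velocity Ltau phi (y, ..., y^(r+1)), so that
    F(x, x') = 0 along it. Steering a to b in time T is therefore an
    interpolation problem without any differential constraint. Every state c
    is the first component of a point of the manifold F = 0, and Phi is onto
    that manifold, so phi is onto R^n: let a = phi(A) and b = phi(B). Two-point
    Hermite interpolation ([jet_interpolation]) gives a polynomial curve y whose
    derivatives of order at most r are the rows of A at time 0 and those of B
    at time T, and x then goes from a to b.

    What remains is to recover the control, which is defined by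
    f(x(t), u(t)) = x'(t) for every t since f(x, .) is a bijection onto the
    fibre F(x, .) = 0. It has to be bounded and measurable, and it is in fact
    continuous. The hypotheses only provide a smooth inverse on each
    fibre separately, with nothing said about its dependence on x; joint
    continuity comes from a Newton-type fixed point argument
    ([parametrization_open]): a point (x, p) of the manifold close to
    (x1, f(x1, u1)) is (x, f(x, u)) for some u close to u1. By injectivity this
    u is the one that was chosen, hence the continuity of t |-> u(t). On
    [0, T] the curve x has a continuous velocity, so it is Lipschitz, hence
    absolutely continuous. *)

(** * Two-point Hermite interpolation *)

Lemma root_derivn (R : fieldType) (c : R) (N i : nat) (q : {poly R}) :
  ('X - c%:P) ^+ N %| q -> (i < N)%N -> root q^`(i) c.
Proof.
elim: i N q => [|i IH] [//|N] q dq iN.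
  by rewrite root_factor_theorem (dvdp_trans _ dq)// exprS dvdp_mulr.
rewrite derivSn; apply: (IH N); last by [].
have /dvdpP[s ->] := dq.
rewrite derivM deriv_exp derivXsubC mul1r /= dvdp_add ?dvdp_mull//.
  by rewrite exprS dvdp_mull.
by rewrite -mulr_natr dvdp_mulr.
Qed.

Definition taylor_poly (R : fieldType) (c : R) (N : nat) (A : nat -> R) : {poly R} :=
  (\poly_(i < N) (A i / i`!%:R)) \Po ('X - c%:P).

Lemma derivn_shift (R : comNzRingType) (c : R) (q : {poly R}) i :
  (q \Po ('X - c%:P))^`(i) = q^`(i) \Po ('X - c%:P).
Proof.
elim: i => [|i IH]; first by rewrite !derivn0.
by rewrite !derivnS IH deriv_comp derivB derivX derivC subr0 mulr1.
Qed.

Lemma derivn_taylor_poly (R : numFieldType) (c : R) (N : nat) (A : nat -> R) i :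
  (i < N)%N -> (taylor_poly c N A)^`(i).[c] = A i.
Proof.
move=> iN; rewrite derivn_shift horner_comp !hornerE subrr horner_coef0.
rewrite coef_derivn addn0 ffactnn coef_poly iN.
by rewrite -[_ *+ _]mulr_natr divfK// pnatr_eq0 -lt0n fact_gt0.
Qed.

(** With u (X - a)^N + v (X - b)^N = 1, the weight v (X - b)^N is 1 modulo
    (X - a)^N and 0 modulo (X - b)^N, and u (X - a)^N behaves the other way
    round: these weights glue the two Taylor polynomials. *)
Lemma hermite_interpolation (R : numFieldType) (a b : R) (N : nat) (A B : nat -> R) :
  a != b -> exists p : {poly R}, forall i, (i < N)%N ->
    p^`(i).[a] = A i /\ p^`(i).[b] = B i.
Proof.
move=> ab.
have /Bezout_eq1_coprimepP[[u v] /= uv1] :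
    coprimep (('X - a%:P) ^+ N) (('X - b%:P) ^+ N).
  by apply/coprimep_expl/coprimep_expr; rewrite coprimep_XsubC2// subr_eq0 eq_sym.
set P := taylor_poly a N A; set Q := taylor_poly b N B.
(* Contact of order N at c means equal derivatives of order less than N. *)
have contact c (p q : {poly R}) i : ('X - c%:P) ^+ N %| p - q -> (i < N)%N ->
    p^`(i).[c] = q^`(i).[c].
  move=> pq iN; apply/eqP; rewrite -subr_eq0 -hornerN -hornerD -derivnB.
  exact: root_derivn pq iN.
exists (v * ('X - b%:P) ^+ N * P + u * ('X - a%:P) ^+ N * Q) => i iN.
split.
  rewrite -(derivn_taylor_poly a A iN); apply: contact => //.
  suff -> : v * ('X - b%:P) ^+ N * P + u * ('X - a%:P) ^+ N * Q - P =
      u * (Q - P) * ('X - a%:P) ^+ N by rewrite dvdp_mull.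
  rewrite -[in X in _ - X](mul1r P) -uv1; ring.
rewrite -(derivn_taylor_poly b B iN); apply: contact => //.
suff -> : v * ('X - b%:P) ^+ N * P + u * ('X - a%:P) ^+ N * Q - Q =
    v * (P - Q) * ('X - b%:P) ^+ N by rewrite dvdp_mull.
rewrite -[in X in _ - X](mul1r Q) -uv1; ring.
Qed.

(** * Estimates for matrix-valued maps *)

Lemma mx_norm_ge_entry (R : realType) (m n : nat) (M : 'M[R]_(m, n)) i j :
  `|M i j| <= `|M|.
Proof.
rewrite [leRHS]/Num.Def.normr/= mx_normrE.
exact: (le_bigmax _ (fun ij => `|M ij.1 ij.2|) (i, j)).
Qed.

Lemma mx_norm_le (R : realType) (m n : nat) (M : 'M[R]_(m, n)) (C : R) :
  0 <= C -> (forall i j, `|M i j| <= C) -> `|M| <= C.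
Proof.
by move=> C0 MC; rewrite [leLHS]/Num.Def.normr/= mx_normrE bigmax_le.
Qed.

Lemma mulmx_norm_le (R : realType) (m n p : nat) (B : 'M[R]_(n, p)) :
  exists2 k : R, 0 < k & forall v : 'M[R]_(m, n), `|v *m B| <= k * `|v|.
Proof.
have k0 : 0 <= `|B| *+ n by rewrite mulrn_wge0.
exists (`|B| *+ n + 1); first by rewrite ltr_wpDl.
move=> v; apply: mx_norm_le => [|i j]; first by rewrite mulr_ge0// addr_ge0.
apply: (@le_trans _ _ (`|B| *+ n * `|v|)); last by rewrite ler_wpM2r// lerDl.
rewrite mxE (le_trans (ler_norm_sum _ _ _))//.
have -> : `|B| *+ n * `|v| = \sum_(l < n) `|B| * `|v|.
  by rewrite sumr_const card_ord mulrnAl.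
by apply: ler_sum => l _; rewrite normrM mulrC ler_pM// mx_norm_ge_entry.
Qed.

(** The norm of a matrix is the largest absolute value of its entries, so the
    scalar mean value theorem, applied to each entry, suffices. *)
Lemma mean_value (R : realType) (m n : nat) (g dg : R -> 'M[R]_(m, n)) (C a b : R) :
  a <= b -> (forall t, a <= t <= b -> is_derive t 1 g (dg t) /\ `|dg t| <= C) ->
  `|g b - g a| <= C * (b - a).
Proof.
move=> ab gab; have C0 : 0 <= C.
  have /gab[_] : a <= a <= b by rewrite lexx.
  exact: le_trans.
apply: mx_norm_le => [|i j]; first by rewrite mulr_ge0// subr_ge0.
have dgij t : a <= t <= b -> is_derive t 1 (fun s => g s i j) (dg t i j).
  move=> /gab[[dgt <-] _]; apply: DeriveDef; first by move/derivable_mxP: dgt.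
  by rewrite derive_mx// mxE.
have cont : {within `[a, b], continuous (fun s => g s i j)}.
  apply: derivable_within_continuous => t /[!in_itv]/= /dgij dt.
  by case: dt.
have [|c] := @MVT_segment R _ (fun t => dg t i j) a b ab _ cont.
  by move=> t /[!in_itv]/= /andP[ta tb]; apply: dgij; rewrite !ltW.
rewrite in_itv /= => cab gij.
rewrite !mxE gij normrM (ger0_norm (_ : 0 <= b - a)) ?subr_ge0// ler_wpM2r ?subr_ge0//.
by rewrite (le_trans (mx_norm_ge_entry _ _ _))//; have [] := gab c cab.
Qed.

(** * Curves made of successive derivatives *)

Lemma is_derive_mx (R : realType) (m n : nat) (V : normedModType R)
    (M : V -> 'M[R]_(m, n)) (dM : 'M[R]_(m, n)) (t v : V) :
  (forall i j, is_derive t v (fun s => M s i j) (dM i j)) ->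
  is_derive t v M dM.
Proof.
move=> dMt; have Mt : derivable M t v by apply/derivable_mxP => i j; apply: ex_derive.
apply: DeriveDef => //; rewrite derive_mx//; apply/matrixP => i j.
by rewrite mxE; apply: derive_val.
Qed.

(** The rows are (y, y', ..., y^(N-1)) at time t, the layout in which [phi] and
    [Ltau phi] take their arguments. *)
Definition jet (R : realType) (m N : nat) (y : 'I_m -> {poly R}) (t : R) : 'M[R]_(N, m) :=
  \matrix_(i, j) (y j)^`(i).[t].

Lemma is_derive_jet (R : realType) (m N : nat) (y : 'I_m -> {poly R}) (t : R) :
  is_derive t 1 (jet N y) (\sum_(i < N) in_row i (row (lift ord0 i) (jet N.+1 y t))).
Proof.
apply: is_derive_mx => i j; rewrite summxE (bigD1 i)//= big1 ?addr0.
  rewrite (_ : (fun _ => _) = horner (y j)^`(i)); last by apply/funext => s; rewrite mxE.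
  rewrite !mxE big_ord1 !mxE !eqxx mul1r lift0 derivnS; exact: is_derive_poly.
by move=> k ki; rewrite !mxE big_ord1 !mxE eq_sym (negPf ki) mul0r.
Qed.

Lemma continuous_jet (R : realType) (m N : nat) (y : 'I_m -> {poly R}) :
  continuous (jet N y).
Proof.
move=> t; apply/differentiable_continuous/derivable1_diffP.
by have [] := is_derive_jet N y t.
Qed.

Lemma row'_jet (R : realType) (m N : nat) (y : 'I_m -> {poly R}) (t : R) :
  row' ord_max (jet N.+1 y t) = jet N y t.
Proof. by apply/matrixP => i j; rewrite !mxE lift_max. Qed.

(** The columns are independent of each other: each is a scalar Hermite
    problem. *)
Lemma jet_interpolation (R : realType) (m N : nat) (a b : R) (A B : 'M[R]_(N, m)) :
  a != b -> exists y : 'I_m -> {poly R}, jet N y a = A /\ jet N y b = B.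
Proof.
move=> ab.
(* The interpolation data are indexed by nat: column j is padded with 0. *)
pose entry (M : 'M[R]_(N, m)) j i := oapp (fun k : 'I_N => M k j) 0 (insub i).
have [y yAB] := choice (fun j => hermite_interpolation N (entry A j) (entry B j) ab).
by exists y; split; apply/matrixP => i j; rewrite mxE;
  have [yA yB] := yAB j i (ltn_ord i); rewrite ?yA ?yB /entry valK.
Qed.

(** [Ltau] is the total derivative along jets: the chain rule applied to
    [is_derive_jet]. *)
Lemma is_derive_along_jet (R : realType) (n m r : nat) (phi : 'M[R]_(r.+1, m) -> 'rV[R]_n)
    (y : 'I_m -> {poly R}) (t : R) :
  differentiable phi (jet r.+1 y t) ->
  is_derive t 1 (phi \o jet r.+1 y) (Ltau phi (jet r.+2 y t)).
Proof.
move=> dphi; have djet := is_derive_jet r.+1 y t.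
have dj : differentiable (jet r.+1 y) t by apply/derivable1_diffP; case: djet.
have dc : differentiable (phi \o jet r.+1 y) t by exact: differentiable_comp.
apply: DeriveDef; first exact/derivable1_diffP.
rewrite deriveE// diff_comp//= -[in X in 'd phi _ X]deriveE// derive_val.
rewrite linear_sum /Ltau row'_jet.
by apply: eq_bigr => i _; rewrite deriveE.
Qed.

(** * Strict differentiability in the second variable *)

Lemma smooth_C1 (R : realType) (V W : normedModType R) (f : V -> W) : smooth f ->
  (forall x, differentiable f x) /\ (forall v, continuous ('D_v f)).
Proof. by move=> /(_ 1%N)[df cf]; split=> [x|v x]; [exact: df|exact: cf]. Qed.

Lemma derive_slice (R : realType) (X Y W : normedModType R) (f : X * Y -> W) x u v :
  'D_v (fun u => f (x, u)) u = 'D_((0, v)) f (x, u).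
Proof.
rewrite /derive.
have -> : (fun h : R => h^-1 *: ((fun u => f (x, u)) (h *: v + u) - f (x, u))) =
          (fun h : R => h^-1 *: (f (h *: (0 : X, v) + (x, u)) - f (x, u))).
  apply/funext => h; congr (_ *: (f _ - _)).
  by congr pair; rewrite /= scaler0 add0r.
by [].
Qed.

Lemma differentiable_slice (R : realType) (X Y W : normedModType R) (f : X * Y -> W) x u :
  differentiable f (x, u) -> differentiable (fun u => f (x, u)) u.
Proof.
have dpair : differentiable (fun u : Y => (x, u)) u.
  exact: (differentiable_pair (differentiable_cst x u)).
exact: differentiable_comp.
Qed.

Lemma is_derive_line (R : realType) (V W : normedModType R) (h : V -> W)
    (u w : V) (t : R) :
  differentiable h (u + t *: w) ->
  is_derive t 1 (fun t => h (u + t *: w)) ('D_w h (u + t *: w)).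
Proof.
have lineE : (fun s : R => s^-1 *: (((fun t : R => h (u + t *: w)) \o shift t) (s *: 1) -
                                   h (u + t *: w))) =
             (fun s : R => s^-1 *: ((h \o shift (u + t *: w)) (s *: w) - h (u + t *: w))).
  apply/funext => s; congr (_ *: (h _ - _)).
  by rewrite /= scalerDl addrCA /GRing.scale/= mulr1.
move=> /(@diff_derivable _ _ _ _ _ w); rewrite /derivable -lineE => dl.
apply: DeriveDef; first by [].
exact: (congr1 (fun g : R -> W => lim (g s @[s --> 0^'])) lineE).
Qed.

(** For a C^1 map, the linear approximation of f(x, .) taken at the single
    point (x1, u1) is accurate to order e on a full neighbourhood, uniformly
    in x. The increment along the segment from u to u + w is controlled by the
    mean value inequality, and the derivative in direction w is a combination
    of the m partial derivatives, which are continuous at (x1, u1). *)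
Lemma strictly_differentiable_slice (R : realType) (X : normedModType R) (m k : nat)
    (f : X * 'rV[R]_m -> 'rV[R]_k) (x1 : X) (u1 : 'rV[R]_m) (e : R) :
  (forall z, differentiable f z) -> (forall v, continuous ('D_v f)) -> 0 < e ->
  exists2 d : R, 0 < d & forall x u w,
    `|x - x1| < d -> `|u - u1| < d -> `|u + w - u1| < d ->
    `|f (x, u + w) - f (x, u) - w *m jacobian (fun u => f (x1, u)) u1| <= e * `|w|.
Proof.
move=> df cf e0; pose e1 := e / m.+1%:R.
have e10 : 0 < e1 by rewrite divr_gt0.
(* Each of the m coordinates of w is bounded by its norm: e1 makes the m errors
   add up to at most e * `|w|. *)
have near_partials : \forall z \near (x1, u1), forall j : 'I_m,
    `|'D_((0, delta_mx ord0 j)) f (x1, u1) - 'D_((0, delta_mx ord0 j)) f z| < e1.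
  apply: (@filter_forall _ _ _ _ (nbhs_filter ((x1, u1) : X * _))) => j.
  by move/cvgrPdist_lt: (cf (0, delta_mx ord0 j) (x1, u1)); apply.
have [d d0 dP] := (nbhs_ballP _ _).1 near_partials.
exists d => // x u w xd ud uwd.
have slice x' v : differentiable (fun u => f (x', u)) v by exact: differentiable_slice.
have wJ x' v : w *m jacobian (fun u => f (x', u)) v =
    \sum_j w ord0 j *: 'D_((0, delta_mx ord0 j)) f (x', v).
  rewrite [in LHS](row_sum_delta w) mulmx_suml; apply: eq_bigr => j _.
  by rewrite -scalemxAl -deriveEjacobian ?derive_slice.
(* g is the increment with its linear part removed: dg compares the partial
   differentials at two nearby points. *)
pose g (t : R) := f (x, u + t *: w) - t *: (w *m jacobian (fun u => f (x1, u)) u1).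
pose dg (t : R) := w *m jacobian (fun u => f (x, u)) (u + t *: w) -
  w *m jacobian (fun u => f (x1, u)) u1.
suff : `|g 1 - g 0| <= e * `|w| * (1 - 0).
  by rewrite /g !scale1r !scale0r !addr0 subr0 subr0 mulr1 addrAC.
apply: (@mean_value R _ _ g dg) => // t /andP[t0 t1]; split.
  have d1 : is_derive t 1 (fun t => f (x, u + t *: w))
      (w *m jacobian (fun u => f (x, u)) (u + t *: w)).
    rewrite -(deriveEjacobian w (slice x _)).
    exact: (@is_derive_line R _ _ (fun u => f (x, u)) u w t (slice x _)).
  pose v := w *m jacobian (fun u => f (x1, u)) u1.
  have d2 : is_derive t 1 (fun t : R => t *: v) v.
    have dZ := is_diff_scalel t v.
    apply: DeriveDef; first exact/derivable1_diffP.
    by rewrite deriveE// diff_val scale1r.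
  exact: (@is_deriveB _ _ _ _ _ _ _ _ _ d1 d2).
(* Balls are convex. *)
have td : `|u + t *: w - u1| < d.
  rewrite (_ : _ - _ = (1 - t) *: (u - u1) + t *: (u + w - u1)); last first.
    by rewrite [u + w - u1]addrAC (scalerDr t) addrA -scalerDl subrK scale1r addrAC.
  rewrite (le_lt_trans (ler_normD _ _))// !normrZ (ger0_norm t0).
  rewrite ger0_norm ?subr_ge0//.
  have [t1'|t1'] := ltP t 1; last first.
    have -> : t = 1 by apply/le_anti/andP.
    by rewrite subrr mul0r add0r mul1r.
  apply: (@lt_le_trans _ _ ((1 - t) * d + t * d)).
    by rewrite ltr_leD// ?ltr_pM2l ?subr_gt0// ler_wpM2l// ltW.
  by rewrite -mulrDl subrK mul1r.
have -> : dg t = \sum_j w ord0 j *: ('D_((0, delta_mx ord0 j)) f (x, u + t *: w) -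
    'D_((0, delta_mx ord0 j)) f (x1, u1)).
  transitivity (\sum_j w ord0 j *: 'D_((0, delta_mx ord0 j)) f (x, u + t *: w) -
                \sum_j w ord0 j *: 'D_((0, delta_mx ord0 j)) f (x1, u1)).
    exact: (congr2 (fun a b => a - b) (wJ x (u + t *: w)) (wJ x1 u1)).
  by rewrite -sumrB; apply: eq_bigr => j _; rewrite scalerBr.
apply: (le_trans (ler_norm_sum _ _ _)).
apply: (@le_trans _ _ (\sum_(j < m) `|w| * e1)).
  apply: ler_sum => j _; rewrite normrZ; apply: ler_pM => //.
    exact: mx_norm_ge_entry.
  rewrite distrC; apply/ltW/dP.
  split=> /=; rewrite -ball_normE /ball_/= distrC//.
rewrite sumr_const card_ord -mulrnAr mulrC ler_wpM2r//.
by rewrite /e1 -mulr_natr mulrAC ler_pdivrMr// ler_pM2l// ler_nat.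
Qed.

(** * Solving for the control *)

(** Completeness of the space of controls is what the fixed point theorem needs. *)
HB.instance Definition _ (R : realType) (m n : nat) :=
  Uniform_isComplete.Build 'M[R]_(m, n) cauchy_cvg.

(** Fixed points of u |-> u - g u are zeros of g, and this map is a contraction
    with factor 1/2. *)
Lemma near_identity_zero (R : realType) (X : completeNormedModType R) (g : X -> X)
    (u1 : X) (d rho : R) :
  (forall u w, `|u - u1| < d -> `|u + w - u1| < d ->
     `|g (u + w) - g u - w| <= 2^-1 * `|w|) ->
  0 < rho < d -> `|g u1| <= 2^-1 * rho ->
  exists2 u, `|u - u1| <= rho & g u = 0.
Proof.
move=> gP /andP[rho0 rhod] gu1.
pose U := closed_ball_ (fun x => `|x|) u1 rho.
have UP u : U u -> `|u - u1| < d.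
  by rewrite /U /closed_ball_/= distrC => /le_lt_trans; apply.
have contr u v : U u -> U v -> `|(v - g v) - (u - g u)| <= 2^-1 * `|v - u|.
  move=> /UP ud vU; have vd := UP _ vU.
  have := gP u (v - u) ud; rewrite (addrC u) subrK => /(_ vd).
  rewrite -normrN [in X in `|X|]opprB !opprB.
  by rewrite addrACA [- u - _]addrC -addrACA.
have stable : {homo (fun u => u - g u) : u / U u >-> U u}.
  move=> u Uu; rewrite /U /closed_ball_/= distrC.
  have U1 : U u1 by rewrite /U /closed_ball_/= subrr normr0 ltW.
  have := contr u1 u U1 Uu.
  have -> : u - g u - u1 = u - g u - (u1 - g u1) - g u1.
    by rewrite opprB addrA addrAC addrK.
  move=> uu1; rewrite (le_trans (ler_normB _ _))//.
  have : `|u - u1| <= rho by rewrite distrC.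
  lra.
pose fU := isFun.Build X X U U (fun u => u - g u) stable.
pose T : {fun U >-> U} := HB.pack (fun u => u - g u) fU.
have T_contr : is_contraction T.
  exists (2^-1)%:nng; split; first by rewrite /= invf_lt1// ltr1n.
  by move=> [u v] [Uu Uv] /=; exact: contr.
have [||u Uu /= uE] := banach_fixed_point T_contr.
- exact: closed_closed_ball_.
- by exists u1; rewrite /U /closed_ball_/= subrr normr0 ltW.
exists u; first by rewrite distrC.
by rewrite -[LHS](subKr u) -uE subrr.
Qed.

Lemma continuous_pair_dist (R : realType) (X Y W : normedModType R) (f : X * Y -> W)
    x1 y1 (e : R) :
  {for (x1, y1), continuous f} -> 0 < e ->
  exists2 d : R, 0 < d & forall x y,
    `|x - x1| < d -> `|y - y1| < d -> `|f (x, y) - f (x1, y1)| < e.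
Proof.
move=> /cvgrPdist_lt cf e0; have [d /= d0 dP] := (nbhs_ballP _ _).1 (cf e e0).
exists d => // x y xd yd; rewrite distrC; apply: dP.
by split=> /=; rewrite -ball_normE /ball_/= distrC.
Qed.

Lemma jacobian_left_inverse (R : realType) (m n : nat)
    (g : 'rV[R]_m -> 'rV[R]_n) (h : 'rV[R]_n -> 'rV[R]_m) (u : 'rV[R]_m) :
  differentiable g u -> differentiable h (g u) -> (\forall v \near u, h (g v) = v) ->
  jacobian g u *m jacobian h (g u) = 1%:M.
Proof.
move=> dg dh hg; apply/row_matrixP => i; rewrite row1 rowE mulmxA.
rewrite -!deriveEjacobian// -[RHS](derive_id u) -(near_eq_derive _ hg).
rewrite [RHS]deriveE; last exact: differentiable_comp.
by rewrite diff_comp//= [in LHS]deriveE// (deriveE _ dg).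
Qed.

(** The range of D lies in the kernel of J and both have dimension m, so they
    coincide; as E is injective on the range of D, no nonzero vector is killed
    by J and E at once. Hence row_mx J E has a right inverse, and B is the block
    of this inverse that multiplies J. *)
Lemma complementary_kernels (K : fieldType) (m n k : nat) (D : 'M[K]_(m, n))
    (J : 'M[K]_(n, k)) (E : 'M[K]_(n, m)) :
  D *m E = 1%:M -> D *m J = 0 -> \rank J = k -> (m + k = n)%N ->
  exists B : 'M[K]_(k, n), forall v : 'rV_n, v *m E = 0 -> v = v *m J *m B.
Proof.
move=> DE DJ rJ mkn.
have rD : \rank D = m.
  by apply/eqP/row_freeP; exists E.
have kerJ : (kermx J <= D)%MS.
  have /mxrank_leqif_sup/geq_leqif <- : (D <= kermx J)%MS by apply/sub_kermxP.
  by rewrite mxrank_ker rJ rD -mkn addnK.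
have free : row_free (row_mx J E).
  rewrite -kermx_eq0; apply/rowV0P => v /sub_kermxP.
  rewrite mul_mx_row => /(congr1 (fun M => (lsubmx M, rsubmx M))).
  rewrite row_mxKl row_mxKr linear0 linear0 => -[/eqP vJ vE].
  have /submxP[w vwD] : (v <= D)%MS.
    by apply: submx_trans kerJ; apply/sub_kermxP/eqP.
  by move: vE; rewrite vwD -mulmxA DE mulmx1 => ->; rewrite mul0mx.
have /row_freeP[P JEP] := free.
exists (usubmx P) => v vE.
rewrite -[LHS]mulmx1 -JEP -[P in LHS]vsubmxK mul_row_col mulmxDr !mulmxA vE.
by rewrite mul0mx addr0.
Qed.

(** Local surjectivity of (x, u) |-> (x, f(x, u)) onto F = 0. The system
    f(x, u) = p has n equations for m unknowns; only its m combinations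
    (f(x, u) - p) E = 0 are solved, by iterating the chord map
    u |-> u - (f(x, u) - p) E, where E is a left inverse of the partial
    differential D of f. Then v = f(x, u) - p satisfies v E = 0, while both
    F(x, p) and F(x, p + v) vanish, which bounds v J by a small multiple of v
    for J the partial differential of F. As J is injective on the kernel of E,
    this forces v = 0. *)
Lemma implicit_fiber_solution (R : realType) (X : normedModType R) (m n k : nat)
    (F : X * 'rV[R]_n -> 'rV[R]_k) (f : X * 'rV[R]_m -> 'rV[R]_n)
    (x1 : X) (u1 : 'rV[R]_m) (E : 'M[R]_(n, m)) (rho : R) :
  (forall z, differentiable F z) -> (forall v, continuous ('D_v F)) ->
  (forall z, differentiable f z) -> (forall v, continuous ('D_v f)) ->
  (forall x u, F (x, f (x, u)) = 0) ->
  \rank (jacobian (fun p => F (x1, p)) (f (x1, u1))) = k -> (m + k = n)%N ->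
  jacobian (fun u => f (x1, u)) u1 *m E = 1%:M ->
  0 < rho ->
  exists2 d : R, 0 < d & forall x p,
    `|x - x1| < d -> `|p - f (x1, u1)| < d -> F (x, p) = 0 ->
    exists2 u, `|u - u1| <= rho & f (x, u) = p.
Proof.
move=> dF cF df cf Ff rF mkn DE rho0.
set D := jacobian _ u1 in DE; set J := jacobian _ (f _) in rF.
(* Differentiate F(x1, f(x1, u)) = 0 in u. *)
have DJ : D *m J = 0.
  apply/row_matrixP => i; rewrite row0 rowE mulmxA.
  have dfs : differentiable (fun u => f (x1, u)) u1 by exact: differentiable_slice.
  have dFs : differentiable (fun p => F (x1, p)) (f (x1, u1)).
    exact: differentiable_slice.
  rewrite -!deriveEjacobian// !deriveE// -[LHS]/(('d _ _ \o 'd _ _) _).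
  rewrite -(diff_comp dfs dFs).
  have -> : (fun p => F (x1, p)) \o (fun u => f (x1, u)) = cst 0.
    by apply/funext => u /=.
  by rewrite diff_cst.
have [B BP] := complementary_kernels DE DJ rF mkn.
have [kE kE0 EP] := mulmx_norm_le 1 E.
have [kB kB0 BnP] := mulmx_norm_le 1 B.
have eB0 : 0 < (2 * kB)^-1 by rewrite invr_gt0 mulr_gt0.
have eE0 : 0 < (2 * kE)^-1 by rewrite invr_gt0 mulr_gt0.
have [d1 d10 FP] := @strictly_differentiable_slice R X n k F x1 (f (x1, u1)) _ dF cF eB0.
have [d2 d20 fP] := @strictly_differentiable_slice R X m n f x1 u1 _ df cf eE0.
have fc : {for (x1, u1), continuous f} by exact/differentiable_continuous.
have [d3 d30 fP3] := continuous_pair_dist fc d10.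
(* Balls of radius rho' stay inside the open balls of radii d2 and d3, and the
   bound by rho' / (4 kE) makes the starting residual at u1 at most
   rho' / 2. *)
pose rho' := Num.min rho (Num.min d2 d3 / 2).
have rho'0 : 0 < rho' by rewrite lt_min rho0 divr_gt0// lt_min d20.
have eta0 : 0 < rho' / (4 * kE) by rewrite divr_gt0// mulr_gt0.
have [d4 d40 fP4] := continuous_pair_dist fc eta0.
exists (Num.min d1 (Num.min d2 (Num.min d3 (Num.min d4 (rho' / (4 * kE)))))).
  by rewrite !lt_min d10 d20 d30 d40.
move=> x p; rewrite !lt_min => /and5P[xd1 xd2 xd3 xd4 _] /and5P[pd1 _ _ _ peta] Fxp.
have rho'rho : rho' <= rho by rewrite ge_min lexx.
have rho'd : rho' < Num.min d2 d3.
  have d230 : 0 < Num.min d2 d3 by rewrite lt_min d20.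
  have : rho' <= Num.min d2 d3 / 2 by rewrite ge_min lexx orbT.
  by move=> /le_lt_trans; apply; rewrite ltr_pdivrMr// ltr_pMr// ltr1n.
move: (rho'd); rewrite lt_min => /andP[rho'd2 rho'd3].
have [|||u urho gu0] := @near_identity_zero R 'rV[R]_m
  (fun u => (f (x, u) - p) *m E) u1 d2 rho'.
- move=> u w ud uwd.
  have -> : (f (x, u + w) - p) *m E - (f (x, u) - p) *m E - w =
      (f (x, u + w) - f (x, u) - w *m D) *m E.
    by rewrite -mulmxBl opprB addrA subrK [in RHS]mulmxBl -mulmxA DE mulmx1.
  apply: (le_trans (EP _)); rewrite -ler_pdivlMl//.
  apply: (le_trans (fP _ _ _ xd2 ud uwd)).
  by rewrite invfM mulrCA mulrA.
- by rewrite rho'0.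
- rewrite (le_trans (EP _))// -ler_pdivlMl//.
  have -> : kE^-1 * (2^-1 * rho') = rho' / (4 * kE) + rho' / (4 * kE).
    by field; rewrite gt_eqF.
  rewrite (le_trans (ler_distD (f (x1, u1)) _ _))// lerD//.
    by apply/ltW/fP4 => //; rewrite subrr normr0.
  by rewrite distrC ltW.
exists u; first exact: le_trans rho'rho.
pose v := f (x, u) - p.
have fuE : f (x, u) = p + v by rewrite addrC subrK.
have := FP x p v xd1 pd1; rewrite -fuE Ff Fxp subrr sub0r normrN => vJ.
have {}vJ : `|v *m J| <= (2 * kB)^-1 * `|v|.
  by apply: vJ; apply: fP3 => //; apply: le_lt_trans rho'd3.
have : `|v| <= 2^-1 * `|v|.
  rewrite {1}(BP v gu0) (le_trans (BnP _))// -ler_pdivlMl// (le_trans vJ)//.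
  by rewrite invfM mulrCA mulrA.
have := normr_ge0 v => v0 v2.
have {}v0 : `|v| = 0 by lra.
by apply/eqP; rewrite -subr_eq0 -normr_eq0 -/v v0.
Qed.

(** The smooth inverse h of the single fibre map f(x1, .) serves only at first
    order: its differential is the left inverse E that the fixed point argument
    requires. *)
Lemma parametrization_open (R : realType) (n m : nat) (m_le_n : (m <= n)%N)
    (F : 'rV[R]_n * 'rV[R]_n -> 'rV[R]_(n - m)) (f : 'rV[R]_n * 'rV[R]_m -> 'rV[R]_n)
    (x1 : 'rV[R]_n) (u1 : 'rV[R]_m) (rho : R) :
  smooth F -> smooth f -> (forall x u, F (x, f (x, u)) = 0) ->
  \rank (jacobian (fun p => F (x1, p)) (f (x1, u1))) = (n - m)%N ->
  diffeomorphism_onto [set p | F (x1, p) = 0] (fun u => f (x1, u)) ->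
  0 < rho ->
  exists2 d : R, 0 < d & forall x p,
    `|x - x1| < d -> `|p - f (x1, u1)| < d -> F (x, p) = 0 ->
    exists2 u, `|u - u1| <= rho & f (x, u) = p.
Proof.
move=> /smooth_C1[dF cF] /smooth_C1[df cf] Ff rF [_ _ _ chart] rho0.
have [U [h [Uo Up1 h_smooth hf]]] := chart _ (Ff x1 u1).
have fu1 : differentiable (fun u => f (x1, u)) u1 by exact: differentiable_slice.
apply: (implicit_fiber_solution (E := jacobian h (f (x1, u1)))
  dF cF df cf Ff rF) => //; first by rewrite subnKC.
apply: jacobian_left_inverse => //.
  by have [dh _] := h_smooth 1%N; exact: dh.
have : nbhs (f (x1, u1)) U by exact: open_nbhs_nbhs.
move=> /(differentiable_continuous fu1) nU.
by near=> v; apply: hf; near: v; exact: nU.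
Unshelve. all: end_near. Qed.

(** * Trajectories *)

Lemma lipschitz_abs_continuous (R : realType) (V : normedModType R) (a b C : R)
    (x : R -> V) :
  0 <= C -> (forall s t, a <= s -> s <= t -> t <= b -> `|x t - x s| <= C * (t - s)) ->
  abs_continuous a b x.
Proof.
move=> C0 xC e e0; exists (e / (C + 1)); first by rewrite divr_gt0// ltr_wpDl.
move=> k s t st _ std; apply: (@le_lt_trans _ _ (C * \sum_(i < k) (t i - s i))).
  by rewrite mulr_sumr ler_sum// => i _; have [as_ [st_ tb]] := st i; exact: xC.
apply: (@le_lt_trans _ _ ((C + 1) * \sum_(i < k) (t i - s i))).
  rewrite ler_wpM2r ?lerDl// sumr_ge0// => i _.
  by rewrite subr_ge0; have [_ []] := st i.
by rewrite mulrC -ltr_pdivlMr// ltr_wpDl.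
Qed.

Lemma continuous_bounded_on_segment (R : realType) (V : normedModType R)
    (u : R -> V) (a b : R) :
  continuous u -> [bounded u t | t in `[a, b]%classic].
Proof.
move=> cu; have : compact (u @` `[a, b]%classic).
  apply: continuous_compact; last exact: segment_compact.
  exact: continuous_subspaceT.
move=> /compact_bounded[M [M_real uM]]; exists M; split=> // K MK t tab.
by apply: (uM K MK); exists t.
Qed.

Theorem proposition4p1 (R : realType) (n m : nat) (m_gt0 : (0 < m)%N)
    (n_gt_m : (m < n)%N)
    (F : 'rV[R]_n * 'rV[R]_n -> 'rV[R]_(n - m)) (F_smooth : smooth F)
    (F_rank : forall x p,
       \rank (jacobian (fun q : 'rV[R]_n => F (x, q)) p) = (n - m)%N)
    (F_solvable : forall x, exists p, F (x, p) = 0)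
    (f : 'rV[R]_n * 'rV[R]_m -> 'rV[R]_n) (f_smooth : smooth f)
    (Ff : forall x u, F (x, f (x, u)) = 0)
    (f_param : forall x,
       diffeomorphism_onto [set p | F (x, p) = 0] (fun u => f (x, u)))
    (r : nat) (phi : 'M[R]_(r.+1, m) -> 'rV[R]_n) (phi_smooth : smooth phi)
    (F_phi : forall Y : 'M[R]_(r.+2, m), F (phi (row' ord_max Y), Ltau phi Y) = 0)
    (phi_submersion : surjective_submersion [set q | F q = 0]
       (fun Y : 'M[R]_(r.+2, m) => (phi (row' ord_max Y), Ltau phi Y)))
    (phi_equilibria : diffeomorphism_onto [set x | F (x, 0) = 0]
       (fun y0 : 'rV[R]_m => phi (in_row ord0 y0))) :
  forall x0 : 'rV[R]_n, F (x0, 0) = 0 -> locally_controllable f x0.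
Proof.
move=> x0 _ T T0; exists setT => [|a b _ _]; first exact: filterT.
have [Phi_smooth Phi_range _] := phi_submersion.
(* Some velocity p is admissible at c, and (c, p) is a value of Phi. *)
have phi_surj c : exists A, phi A = c.
  have [p Fcp] := F_solvable c.
  have : [set q | F q = 0] (c, p) by [].
  by rewrite -Phi_range => -[Y _ [<- _]]; exists (row' ord_max Y).
have [A phiA] := phi_surj a; have [B phiB] := phi_surj b.
have T_neq : 0 != T by rewrite lt_eqF.
have [y [yA yB]] := jet_interpolation A B T_neq.
pose x := phi \o jet r.+1 y; pose p t := Ltau phi (jet r.+2 y t).
have [phi_diff _] := smooth_C1 phi_smooth; have [Phi_diff _] := smooth_C1 Phi_smooth.
have dx (t : R) : is_derive t (1 : R) x (p t) by exact: is_derive_along_jet.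
have Fxp t : F (x t, p t) = 0 by have := F_phi (jet r.+2 y t); rewrite row'_jet.
have cx : continuous x.
  by move=> t; apply/differentiable_continuous/derivable1_diffP; case: (dx t).
have cp : continuous p.
  move=> t; have cPhi := differentiable_continuous (Phi_diff (jet r.+2 y t)).
  have cPhi_jet := continuous_comp (@continuous_jet R m r.+2 y t) cPhi.
  exact: (continuous_comp (g := snd) cPhi_jet cvg_snd).
have /choice[u fu] : forall t, exists v, f (x t, v) = p t.
  move=> t; have [_ _ f_range _] := f_param (x t).
  by have : [set q | F (x t, q) = 0] (p t) by []; rewrite -f_range => -[v _ fv]; exists v.
(* Near time t, the solution provided by [parametrization_open] is u s, since
   f(x s, .) is injective. *)
have cu : continuous u.
  move=> t; apply/cvgrPdist_le => e e0.
  have [d d0 dP] := parametrization_open (ltnW n_gt_m) F_smooth f_smooth Ff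
    (F_rank _ (f (x t, u t))) (f_param (x t)) e0.
  have /cvgrPdist_lt/(_ d d0) xd := cx t; have /cvgrPdist_lt/(_ d d0) pd := cp t.
  near=> s.
  have [||v vu fv] := dP (x s) (p s) _ _ (Fxp s).
  - by rewrite distrC; near: s.
  - by rewrite fu distrC; near: s.
  have [_ f_inj _ _] := f_param (x s).
  by rewrite distrC (f_inj (u s) v)// fv.
exists u, x; split.
- split=> [|j]; first exact: continuous_bounded_on_segment.
  apply: measurable_funTS; apply: measurable_realfun.continuous_measurable_fun => t.
  exact: (continuous_comp (cu t) (@coord_continuous _ _ _ ord0 j _)).
- have [M [_ pM]] := continuous_bounded_on_segment 0 T cp.
  have M_lt : M < `|M| + 1 by rewrite (le_lt_trans (ler_norm M))// ltrDl.
  apply: (@lipschitz_abs_continuous _ _ _ _ (`|M| + 1)) => [|s t s0 st tT].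
    by rewrite addr_ge0.
  apply: (mean_value (dg := p)) => // v /andP[sv vt]; split=> //.
  apply: (pM _ M_lt); rewrite /= in_itv/=.
  by rewrite (le_trans s0)// (le_trans vt).
- by apply: aeW => t _; rewrite fu.
- by rewrite /x /= yA yB.
Unshelve. all: end_near. Qed.
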